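(* Let $I\subset(0,1)$ be a segment and let $G$ be a group of diffeomorphisms in $\mathrm{Diff}^1_+([0,1])$ supported in $I$ (i.e. each $g\in G$ is the identity outside $I$) which is $C^1$-close to the identity. Let $f\in \mathrm{Diff}^1_+([0,1])$ be a diffeomorphism without hyperbolic fixed points such that $f(I)\cap I=\emptyset$. Then the group $\langle f,G\rangle$ generated by $f$ and $G$ is $C^1$-close to the identity.
   Context: A group $G\subset \mathrm{Diff}^1_+([0,1])$ is $C^1$-close to the identity if there is a sequence $h_n\in \mathrm{Diff}^1_+([0,1])$ such that $h_n g h_n^{-1}\to \mathrm{id}$ in the $C^1$-topology as $n\to\infty$, for every $g\in G$. A diffeomorphism $f$ is without hyperbolic fixed points if $Df(x)=1$ for every fixed point $x$ of $f$. *)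

(* Defs.v *)
From Stdlib Require Import Reals.
Open Scope R_scope.

Definition in01 (x : R) : Prop := 0 <= x <= 1.

Definition has_deriv01 (f : R -> R) (x l : R) : Prop :=
  forall eps : R, 0 < eps -> exists delta : R, 0 < delta /\
    forall y : R, in01 y -> y <> x -> Rabs (y - x) < delta ->
      Rabs ((f y - f x) / (y - x) - l) < eps.

(* f restricted to [0,1] is an element of Diff^1_+([0,1]):
   f(0)=0, f(1)=1, f is C^1 on [0,1] with positive derivative
   (hence an orientation-preserving C^1 diffeomorphism of [0,1]). *)
Definition Diff1 (f : R -> R) : Prop :=
  f 0 = 0 /\ f 1 = 1 /\
  exists df : R -> R,
    (forall x, in01 x -> has_deriv01 f x (df x)) /\
    (forall x, in01 x -> 0 < df x) /\
    (forall x, in01 x -> forall eps, 0 < eps -> exists delta, 0 < delta /\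
        forall y, in01 y -> Rabs (y - x) < delta -> Rabs (df y - df x) < eps).

Definition inverse01 (h k : R -> R) : Prop :=
  forall x, in01 x -> k (h x) = x /\ h (k x) = x.

Definition IsGroup (G : (R -> R) -> Prop) : Prop :=
  (forall g, G g -> Diff1 g) /\
  G (fun x => x) /\
  (forall g h, G g -> G h -> G (fun x => g (h x))) /\
  (forall g, G g -> exists k, G k /\ inverse01 g k).

Definition C1_conv_id (c : nat -> R -> R) : Prop :=
  forall eps : R, 0 < eps -> exists N : nat, forall n : nat, (N <= n)%nat ->
    forall x, in01 x ->
      Rabs (c n x - x) < eps /\
      exists l, has_deriv01 (c n) x l /\ Rabs (l - 1) < eps.

Definition C1_close_to_id (G : (R -> R) -> Prop) : Prop :=
  exists h hinv : nat -> R -> R,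
    (forall n, Diff1 (h n) /\ Diff1 (hinv n) /\ inverse01 (h n) (hinv n)) /\
    forall g, G g -> C1_conv_id (fun n x => h n (g (hinv n x))).

Definition no_hyperbolic_fixed_points (f : R -> R) : Prop :=
  forall x, in01 x -> f x = x -> forall l, has_deriv01 f x l -> l = 1.

Definition supported_in (a b : R) (g : R -> R) : Prop :=
  forall x, in01 x -> (x < a \/ b < x) -> g x = x.

Inductive gen_group (f : R -> R) (G : (R -> R) -> Prop) : (R -> R) -> Prop :=
  | gen_id : gen_group f G (fun x => x)
  | gen_f : gen_group f G f
  | gen_G : forall g, G g -> gen_group f G g
  | gen_comp : forall g h, gen_group f G g -> gen_group f G h ->
      gen_group f G (fun x => g (h x))
  | gen_inv : forall g k, gen_group f G g -> Diff1 k -> inverse01 g k ->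
      gen_group f G k.

(* Main.v *)
Require Import Defs.
From Stdlib Require Import Reals Lra Lia ClassicalEpsilon.
From Coquelicot Require Import Coquelicot.
Open Scope R_scope.

(** Put u = log Dh. Since log D(h g h^-1) at the point h x equals
    u(g x) + log Dg(x) - u(x), the conjugates of g by h_n tend to the identity
    as soon as these defects tend to 0 uniformly, and every continuous u is
    log Dh up to an additive constant, which does not matter. So one needs
    continuous functions u_n whose defects tend to 0 for f and for every g in G.
    For G they are given, v_n say. For f the Cesaro means w_n of the Birkhoff sums of
    log Df have defect (1/n) log Df^n, which tends to 0: log Df vanishes at the
    fixed points, hence |log Df| <= e + C |f x - x|, and the displacements
    along a monotone orbit add up to at most 1. The defect of g in G only sees
    u on I, so w_n + S works if S = v_n - w_n on I and S is almost f-invariant.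
    As I is wandering, S is obtained by spreading a bump extension of v_n - w_n
    along the orbit of I with weights decreasing linearly from 1 to 0 over a long time. *)

(** * Continuous functions on the unit interval *)

Definition clamp01 (x : R) : R := Rmax 0 (Rmin 1 x).

Lemma clamp01_in (x : R) : in01 (clamp01 x).
Proof.
  unfold clamp01, in01, Rmax, Rmin.
  destruct (Rle_dec 1 x), (Rle_dec 0 _); lra.
Qed.

Lemma clamp01_id (x : R) : in01 x -> clamp01 x = x.
Proof.
  unfold clamp01, in01, Rmax, Rmin; intros Hx.
  destruct (Rle_dec 1 x), (Rle_dec 0 _); lra.
Qed.

Lemma clamp01_lipschitz (x y : R) : Rabs (clamp01 x - clamp01 y) <= Rabs (x - y).
Proof.
  unfold clamp01, Rmax, Rmin, Rabs.
  repeat (destruct (Rle_dec _ _) || destruct (Rcase_abs _)); lra.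
Qed.

(* Continuity of the restriction to [0,1]; the clamp turns it into continuity on the line. *)
Definition cont01 (u : R -> R) : Prop :=
  forall x, continuous (fun y => u (clamp01 y)) x.

(** Links the filter form, which gives the closure properties below, with the epsilon-delta form
    used in [Diff1]. *)
Lemma cont01P (u : R -> R) :
  cont01 u <->
  forall x, in01 x -> forall eps, 0 < eps -> exists delta, 0 < delta /\
    forall y, in01 y -> Rabs (y - x) < delta -> Rabs (u y - u x) < eps.
Proof.
  split.
  - intros Hu x Hx eps Heps.
    destruct (proj1 (filterlim_locally _ _) (Hu x) (mkposreal eps Heps)) as [d Hd].
    exists d; split; [apply cond_pos|]; intros y Hy Hyx.
    specialize (Hd y Hyx). rewrite !clamp01_id in Hd; auto.
  - intros Hu x. apply filterlim_locally; intros eps.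
    destruct (Hu (clamp01 x) (clamp01_in x) eps (cond_pos eps)) as [d [Hd0 Hd]].
    exists (mkposreal d Hd0); intros y Hy.
    apply Hd; [apply clamp01_in|].
    eapply Rle_lt_trans; [apply clamp01_lipschitz|exact Hy].
Qed.

Lemma cont01_plus (u v : R -> R) : cont01 u -> cont01 v -> cont01 (fun x => u x + v x).
Proof. intros Hu Hv x; apply @continuous_plus; auto. Qed.

Lemma cont01_minus (u v : R -> R) : cont01 u -> cont01 v -> cont01 (fun x => u x - v x).
Proof. intros Hu Hv x; apply @continuous_minus; auto. Qed.

Lemma cont01_mult (u v : R -> R) : cont01 u -> cont01 v -> cont01 (fun x => u x * v x).
Proof. intros Hu Hv x; apply @continuous_mult; auto. Qed.

Lemma cont01_const (c : R) : cont01 (fun _ => c).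
Proof. intros x; apply continuous_const. Qed.

Lemma cont01_of_continuous (u : R -> R) : (forall x, continuous u x) -> cont01 u.
Proof.
  intros Hu. apply cont01P; intros x _ eps Heps.
  destruct (proj1 (filterlim_locally _ _) (Hu x) (mkposreal eps Heps)) as [d Hd].
  exists d; split; [apply cond_pos|]; intros y _ Hyx; exact (Hd y Hyx).
Qed.

Lemma cont01_comp (u g : R -> R) :
  cont01 u -> cont01 g -> (forall x, in01 x -> in01 (g x)) -> cont01 (fun x => u (g x)).
Proof.
  intros Hu Hg Hm x.
  apply (continuous_ext (fun y => u (clamp01 (g (clamp01 y))))).
  { intros y; rewrite (clamp01_id (g _)); auto using clamp01_in. }
  apply (continuous_comp (fun y => g (clamp01 y)) (fun z => u (clamp01 z))); auto.
Qed.

Lemma cont01_post (k u : R -> R) :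
  cont01 u -> (forall x, in01 x -> continuous k (u x)) -> cont01 (fun x => k (u x)).
Proof.
  intros Hu Hk x.
  apply (continuous_comp (fun y => u (clamp01 y)) k); auto using clamp01_in.
Qed.

Lemma cont01_ext (u v : R -> R) :
  (forall x, in01 x -> u x = v x) -> cont01 u -> cont01 v.
Proof.
  intros E Hu x. apply (continuous_ext (fun y => u (clamp01 y))); auto using clamp01_in.
Qed.

Lemma cont01_min (u : R -> R) :
  cont01 u -> exists m, in01 m /\ forall x, in01 x -> u m <= u x.
Proof.
  intros Hu.
  destruct (continuity_ab_min (fun y => u (clamp01 y)) 0 1) as [m [Hm Hi]]; [lra| |].
  { intros c _; apply continuity_pt_filterlim; apply Hu. }
  exists m; split; [exact Hi|]; intros x Hx.
  generalize (Hm x Hx); rewrite !clamp01_id; auto.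
Qed.

Lemma cont01_bounded (u : R -> R) :
  cont01 u -> exists M, 0 < M /\ forall x, in01 x -> Rabs (u x) <= M.
Proof.
  intros Hu.
  destruct (cont01_min (fun x => 0 - Rabs (u x))) as [m [Hi Hm]].
  { apply cont01_minus; [apply cont01_const|].
    apply cont01_post; auto; intros; apply continuous_Rabs. }
  exists (Rabs (u m) + 1); split; [generalize (Rabs_pos (u m)); lra|].
  intros x Hx; generalize (Hm x Hx); lra.
Qed.

(** * Derivatives relative to the unit interval *)

(** Multiplying out the quotient removes the condition [y <> x]; in the chain rule [g y] may equal
    [g x]. *)
Lemma has_deriv01P (f : R -> R) (x l : R) :
  has_deriv01 f x l <->
  forall eps, 0 < eps -> exists delta, 0 < delta /\
    forall y, in01 y -> Rabs (y - x) < delta ->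
      Rabs (f y - f x - l * (y - x)) <= eps * Rabs (y - x).
Proof.
  split; intros H eps Heps.
  - destruct (H eps Heps) as [d [Hd0 Hd]]; exists d; split; auto.
    intros y Hy Hyx. destruct (Req_dec y x) as [->|n].
    { replace (_ - _) with 0 by ring; rewrite Rabs_R0.
      apply Rmult_le_pos; [lra|apply Rabs_pos]. }
    specialize (Hd y Hy n Hyx).
    replace (f y - f x - l * (y - x)) with (((f y - f x) / (y - x) - l) * (y - x))
      by (field; lra).
    rewrite Rabs_mult; apply Rmult_le_compat_r; [apply Rabs_pos|lra].
  - destruct (H (eps / 2)) as [d [Hd0 Hd]]; [lra|]; exists d; split; auto.
    intros y Hy n Hyx. specialize (Hd y Hy Hyx).
    assert (P : 0 < Rabs (y - x)) by (apply Rabs_pos_lt; lra).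
    apply Rle_lt_trans with (eps / 2); [|lra].
    apply Rmult_le_reg_r with (Rabs (y - x)); auto.
    rewrite <- Rabs_mult.
    replace (((f y - f x) / (y - x) - l) * (y - x)) with (f y - f x - l * (y - x))
      by (field; lra).
    exact Hd.
Qed.

Lemma has_deriv01_ext (f g : R -> R) (x l : R) :
  in01 x -> (forall y, in01 y -> f y = g y) -> has_deriv01 f x l -> has_deriv01 g x l.
Proof.
  intros Hx E H eps Heps. destruct (H eps Heps) as [d [Hd0 Hd]].
  exists d; split; auto; intros y Hy. rewrite <- !E; auto.
Qed.

Lemma has_deriv01_cont (f : R -> R) (x l : R) :
  has_deriv01 f x l -> forall eps, 0 < eps -> exists delta, 0 < delta /\
    forall y, in01 y -> Rabs (y - x) < delta -> Rabs (f y - f x) < eps.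
Proof.
  intros H eps Heps.
  destruct (proj1 (has_deriv01P f x l) H 1) as [d [Hd0 Hd]]; [lra|].
  set (K := Rabs l + 1).
  assert (HK : 0 < K) by (unfold K; generalize (Rabs_pos l); lra).
  assert (HeK : 0 < eps / K) by (apply Rdiv_lt_0_compat; auto).
  exists (Rmin d (eps / K)); split; [apply Rmin_glb_lt; auto|].
  intros y Hy Hyx.
  assert (H1 : Rabs (y - x) < d) by (eapply Rlt_le_trans; [exact Hyx|apply Rmin_l]).
  assert (H2 : Rabs (y - x) < eps / K) by (eapply Rlt_le_trans; [exact Hyx|apply Rmin_r]).
  specialize (Hd y Hy H1).
  apply Rle_lt_trans with (K * Rabs (y - x)).
  - replace (f y - f x) with ((f y - f x - l * (y - x)) + l * (y - x)) by ring.
    eapply Rle_trans; [apply Rabs_triang|]. rewrite Rabs_mult. unfold K; lra.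
  - apply Rmult_lt_reg_r with (/ K); [apply Rinv_0_lt_compat; auto|].
    replace (K * Rabs (y - x) * / K) with (Rabs (y - x)) by (field; lra). exact H2.
Qed.

Lemma in01_accumulation (x d : R) :
  in01 x -> 0 < d -> exists y, in01 y /\ y <> x /\ Rabs (y - x) < d.
Proof.
  intros Hx Hd. unfold in01 in *.
  assert (Hm : 0 < Rmin (1/2) (d/2)) by (apply Rmin_glb_lt; lra).
  generalize (Rmin_l (1/2) (d/2)) (Rmin_r (1/2) (d/2)); intros.
  destruct (Rle_dec x (1/2)).
  - exists (x + Rmin (1/2) (d/2)). rewrite Rabs_pos_eq; lra.
  - exists (x - Rmin (1/2) (d/2)). rewrite Rabs_left; lra.
Qed.

Lemma has_deriv01_unique (f : R -> R) (x l m : R) :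
  in01 x -> has_deriv01 f x l -> has_deriv01 f x m -> l = m.
Proof.
  intros Hx Hl Hm. apply cond_eq; intros eps Heps.
  destruct (Hl (eps / 2)) as [d1 [P1 H1]]; [lra|].
  destruct (Hm (eps / 2)) as [d2 [P2 H2]]; [lra|].
  destruct (in01_accumulation x (Rmin d1 d2)) as [y [Hy [n Hyx]]]; auto.
  { apply Rmin_glb_lt; auto. }
  specialize (H1 y Hy n (Rlt_le_trans _ _ _ Hyx (Rmin_l _ _))).
  specialize (H2 y Hy n (Rlt_le_trans _ _ _ Hyx (Rmin_r _ _))).
  apply Rabs_def2 in H1; apply Rabs_def2 in H2; apply Rabs_def1; lra.
Qed.

Lemma has_deriv01_comp (f g : R -> R) (x l m : R) :
  (forall y, in01 y -> in01 (g y)) ->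
  has_deriv01 g x l -> has_deriv01 f (g x) m ->
  has_deriv01 (fun y => f (g y)) x (m * l).
Proof.
  intros Hg Hl Hm. apply has_deriv01P; intros eps Heps.
  (* The bound [e <= 1] will give |g y - g x| <= (|l| + 1) |y - x|, and the two error terms then add
     up to at most e (|l| + |m| + 1) |y - x|. *)
  set (K := Rabs l + Rabs m + 2).
  assert (Pl := Rabs_pos l); assert (Pm := Rabs_pos m).
  assert (HK : 0 < K) by (unfold K; lra).
  set (e := Rmin 1 (eps / K)).
  assert (He : 0 < e) by (apply Rmin_glb_lt; [lra|apply Rdiv_lt_0_compat; auto]).
  assert (He1 : e <= 1) by apply Rmin_l.
  assert (HeK : e * K <= eps).
  { apply Rle_trans with (eps / K * K); [|right; field; lra].
    apply Rmult_le_compat_r; [lra|apply Rmin_r]. }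
  destruct (proj1 (has_deriv01P _ _ _) Hl e He) as [d1 [P1 H1]].
  destruct (proj1 (has_deriv01P _ _ _) Hm e He) as [d2 [P2 H2]].
  destruct (has_deriv01_cont _ _ _ Hl d2 P2) as [d3 [P3 H3]].
  exists (Rmin d1 d3); split; [apply Rmin_glb_lt; auto|].
  intros y Hy Hyx.
  specialize (H1 y Hy (Rlt_le_trans _ _ _ Hyx (Rmin_l _ _))).
  specialize (H2 (g y) (Hg y Hy) (H3 y Hy (Rlt_le_trans _ _ _ Hyx (Rmin_r _ _)))).
  set (t := Rabs (y - x)) in *.
  assert (Ht : 0 <= t) by apply Rabs_pos.
  set (r := g y - g x - l * (y - x)) in *.
  assert (Hgr : Rabs (g y - g x) <= (Rabs l + 1) * t).
  { replace (g y - g x) with (r + l * (y - x)) by (unfold r; ring).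
    eapply Rle_trans; [apply Rabs_triang|]. rewrite Rabs_mult; fold t. nra. }
  replace (f (g y) - f (g x) - m * l * (y - x))
    with ((f (g y) - f (g x) - m * (g y - g x)) + m * r) by (unfold r; ring).
  eapply Rle_trans; [apply Rabs_triang|]. rewrite Rabs_mult.
  assert (Rabs m * Rabs r <= Rabs m * (e * t)) by (apply Rmult_le_compat_l; auto).
  assert (e * Rabs (g y - g x) <= e * ((Rabs l + 1) * t)) by (apply Rmult_le_compat_l; lra).
  assert (e * K * t <= eps * t) by (apply Rmult_le_compat_r; auto).
  unfold K in *; nra.
Qed.

Lemma is_derive_has_deriv01 (f : R -> R) (x l : R) : is_derive f x l -> has_deriv01 f x l.
Proof.
  intros H eps Heps. apply is_derive_Reals in H.
  destruct (H eps Heps) as [d Hd]. exists d; split; [apply cond_pos|].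
  intros y _ n Hyx. specialize (Hd (y - x)).
  replace (x + (y - x)) with y in Hd by ring. apply Hd; auto; lra.
Qed.

Lemma mean_value01 (f df : R -> R) (x y : R) :
  (forall z, in01 z -> has_deriv01 f z (df z)) -> in01 x -> in01 y -> x <= y ->
  exists c, in01 c /\ f y - f x = df c * (y - x).
Proof.
  unfold in01; intros H Hx Hy Hxy.
  destruct (MVT_gen (fun z => f (clamp01 z)) x y df) as [c [Hc E]].
  - rewrite Rmin_left, Rmax_right by lra; intros z Hz.
    apply is_derive_Reals; intros eps Heps.
    destruct (H z ltac:(lra) eps Heps) as [d [P Hd]].
    (* The radius also keeps [z + h] inside [0,1], where the clamp is the identity. *)
    assert (Pm : 0 < Rmin d (Rmin z (1 - z))) by (repeat apply Rmin_glb_lt; lra).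
    exists (mkposreal _ Pm); simpl; intros h n Hh.
    assert (Hh1 := Rlt_le_trans _ _ _ Hh (Rmin_l _ _)).
    assert (Hh2 := Rlt_le_trans _ _ _ Hh (Rmin_r _ _)).
    assert (Hh3 := Rlt_le_trans _ _ _ Hh2 (Rmin_l _ _)).
    assert (Hh4 := Rlt_le_trans _ _ _ Hh2 (Rmin_r _ _)).
    apply Rabs_def2 in Hh3; apply Rabs_def2 in Hh4.
    rewrite !clamp01_id by (unfold in01; lra).
    replace h with (z + h - z) at 2 by ring.
    apply Hd; [unfold in01; lra|lra|].
    replace (z + h - z) with h by ring; auto.
  - intros z _. apply continuity_pt_filterlim.
    apply (proj2 (cont01P f)); intros w Hw. apply (has_deriv01_cont f w (df w)); auto.
  - rewrite Rmin_left, Rmax_right in Hc by lra.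
    exists c; split; [lra|]. rewrite !clamp01_id in E; auto.
Qed.

(** * The logarithmic derivative and the calculus of [Diff1] *)

Definition deriv01 (f : R -> R) (x : R) : R := epsilon (inhabits 0) (has_deriv01 f x).

Definition logderiv (f : R -> R) (x : R) : R := ln (deriv01 f x).

Lemma logderivP (f : R -> R) (x l : R) :
  in01 x -> has_deriv01 f x l -> logderiv f x = ln l.
Proof.
  intros Hx H. unfold logderiv; f_equal. apply (has_deriv01_unique f x); auto.
  exact (epsilon_spec (inhabits 0) (has_deriv01 f x) (ex_intro _ l H)).
Qed.

Lemma has_deriv01_Diff1 (f : R -> R) (x : R) :
  Diff1 f -> in01 x -> has_deriv01 f x (exp (logderiv f x)).
Proof.
  intros [_ [_ [df [H [P _]]]]] Hx.
  rewrite (logderivP f x (df x)), exp_ln; auto.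
Qed.

Lemma cont01_logderiv (f : R -> R) : Diff1 f -> cont01 (logderiv f).
Proof.
  intros [_ [_ [df [H [P C]]]]].
  apply (cont01_ext (fun x => ln (df x))).
  { intros x Hx; symmetry; apply logderivP; auto. }
  apply cont01_post; [apply cont01P; exact C|].
  intros x Hx. apply (ex_derive_continuous ln).
  exists (/ df x); apply is_derive_Reals, derivable_pt_lim_ln; auto.
Qed.

(** Writing the derivative as an exponential makes positivity automatic and reduces C^1 regularity
    to continuity of u. *)
Lemma Diff1_intro (f u : R -> R) :
  f 0 = 0 -> f 1 = 1 -> cont01 u ->
  (forall x, in01 x -> has_deriv01 f x (exp (u x))) -> Diff1 f.
Proof.
  intros H0 H1 Hu H. split; [auto|split; [auto|]].
  exists (fun x => exp (u x)); split; [auto|split].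
  - intros; apply exp_pos.
  - apply cont01P. apply cont01_post; auto. intros; apply continuous_exp.
Qed.

Lemma Diff1_incr (f : R -> R) (x y : R) :
  Diff1 f -> in01 x -> in01 y -> x < y -> f x < f y.
Proof.
  intros Hf Hx Hy Hxy.
  destruct (mean_value01 f (fun z => exp (logderiv f z)) x y) as [c [Hc E]]; auto; try lra.
  { intros; apply has_deriv01_Diff1; auto. }
  generalize (exp_pos (logderiv f c)); nra.
Qed.

Lemma Diff1_incr_le (f : R -> R) (x y : R) :
  Diff1 f -> in01 x -> in01 y -> x <= y -> f x <= f y.
Proof.
  intros Hf Hx Hy [H| ->]; [left; apply Diff1_incr; auto|lra].
Qed.

Lemma Diff1_lt_inv (f : R -> R) (x y : R) :
  Diff1 f -> in01 x -> in01 y -> f x < f y -> x < y.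
Proof.
  intros Hf Hx Hy H. apply Rnot_le_lt; intros Hle.
  generalize (Diff1_incr_le f y x Hf Hy Hx Hle); lra.
Qed.

Lemma Diff1_in01 (f : R -> R) (x : R) : Diff1 f -> in01 x -> in01 (f x).
Proof.
  intros Hf Hx. assert (H := Hf). destruct H as [H0 [H1 _]]. unfold in01 in *.
  assert (L0 : f 0 <= f x) by (apply Diff1_incr_le; unfold in01; auto; lra).
  assert (L1 : f x <= f 1) by (apply Diff1_incr_le; unfold in01; auto; lra).
  lra.
Qed.

Lemma cont01_Diff1 (f : R -> R) : Diff1 f -> cont01 f.
Proof.
  intros Hf. apply cont01P; intros x Hx.
  exact (has_deriv01_cont f x _ (has_deriv01_Diff1 f x Hf Hx)).
Qed.

Lemma Diff1_id : Diff1 (fun x => x).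
Proof.
  apply (Diff1_intro _ (fun _ => 0)); auto using cont01_const.
  intros x _. rewrite exp_0. apply is_derive_has_deriv01. apply @is_derive_id.
Qed.

Lemma has_deriv01_Diff1_comp (f g : R -> R) (x : R) :
  Diff1 f -> Diff1 g -> in01 x ->
  has_deriv01 (fun y => f (g y)) x (exp (logderiv f (g x) + logderiv g x)).
Proof.
  intros Hf Hg Hx. rewrite exp_plus.
  apply has_deriv01_comp; auto using has_deriv01_Diff1, Diff1_in01.
Qed.

Lemma Diff1_comp (f g : R -> R) : Diff1 f -> Diff1 g -> Diff1 (fun x => f (g x)).
Proof.
  intros Hf Hg. apply (Diff1_intro _ (fun x => logderiv f (g x) + logderiv g x)).
  - destruct Hg as [-> _]; destruct Hf as [-> _]; auto.
  - destruct Hg as [_ [-> _]]; destruct Hf as [_ [-> _]]; auto.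
  - apply cont01_plus; [apply cont01_comp|]; auto using cont01_logderiv, cont01_Diff1, Diff1_in01.
  - intros; apply has_deriv01_Diff1_comp; auto.
Qed.

Lemma logderiv_comp (f g : R -> R) (x : R) :
  Diff1 f -> Diff1 g -> in01 x ->
  logderiv (fun y => f (g y)) x = logderiv f (g x) + logderiv g x.
Proof.
  intros Hf Hg Hx.
  rewrite (logderivP _ x (exp (logderiv f (g x) + logderiv g x))); auto.
  - apply ln_exp.
  - apply has_deriv01_Diff1_comp; auto.
Qed.

Lemma logderiv_id (x : R) : in01 x -> logderiv (fun y => y) x = 0.
Proof.
  intros Hx. rewrite (logderivP _ x 1), ln_1; auto.
  apply is_derive_has_deriv01. apply @is_derive_id.
Qed.

Lemma logderiv_ext (f g : R -> R) (x : R) :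
  Diff1 f -> in01 x -> (forall y, in01 y -> f y = g y) -> logderiv f x = logderiv g x.
Proof.
  intros Hf Hx E. symmetry.
  rewrite (logderivP g x (exp (logderiv f x))), ln_exp; auto.
  apply (has_deriv01_ext f); auto using has_deriv01_Diff1.
Qed.

Lemma logderiv_inverse (g k : R -> R) (x : R) :
  Diff1 g -> Diff1 k -> inverse01 g k -> in01 x ->
  logderiv k x = - logderiv g (k x).
Proof.
  intros Hg Hk I Hx.
  assert (E : logderiv (fun y => g (k y)) x = logderiv (fun y => y) x).
  { apply logderiv_ext; auto using Diff1_comp. intros y Hy; apply I; auto. }
  rewrite logderiv_comp, logderiv_id in E; auto; lra.
Qed.

Lemma inverse01_sym (h k : R -> R) : inverse01 h k -> inverse01 k h.
Proof. intros H x Hx; destruct (H x Hx); auto. Qed.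

(** * Inverses, and diffeomorphisms with prescribed logarithmic derivative *)

Lemma Diff1_surj (h : R -> R) (y : R) :
  Diff1 h -> in01 y -> exists x, in01 x /\ h x = y.
Proof.
  intros Hh Hy. assert (H := Hh); destruct H as [H0 [H1 _]].
  destruct (IVT_gen (fun z => h (clamp01 z)) 0 1 y) as [x [Hx E]].
  - intros z; apply continuity_pt_filterlim, (cont01_Diff1 h Hh).
  - rewrite !clamp01_id, H0, H1, Rmin_left, Rmax_right by (unfold in01; lra); exact Hy.
  - rewrite Rmin_left, Rmax_right in Hx by lra.
    exists x; split; auto. rewrite clamp01_id in E; auto.
Qed.

Lemma Diff1_inverse (h : R -> R) : Diff1 h -> exists k, Diff1 k /\ inverse01 h k.
Proof.
  intros Hh.
  set (k := fun y => epsilon (inhabits 0) (fun x => in01 x /\ h x = y)).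
  assert (Hk : forall y, in01 y -> in01 (k y) /\ h (k y) = y).
  { intros y Hy; unfold k. apply epsilon_spec. apply Diff1_surj; auto. }
  assert (Hkh : forall x, in01 x -> k (h x) = x).
  { intros x Hx. destruct (Hk (h x)) as [I E]; auto using Diff1_in01.
    destruct (Rtotal_order (k (h x)) x) as [L|[L|L]]; auto.
    - generalize (Diff1_incr h _ _ Hh I Hx L); lra.
    - generalize (Diff1_incr h _ _ Hh Hx I L); lra. }
  assert (Hc : cont01 k).
  { (* The derivative of h is at least some exp (- M), so k is Lipschitz. *)
    destruct (cont01_bounded _ (cont01_logderiv h Hh)) as [M [_ HM]].
    assert (HL : forall y z, in01 y -> in01 z -> y <= z ->
                   exp (- M) * (z - y) <= h z - h y).
    { intros y z Hy Hz Hyz.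
      destruct (mean_value01 h (fun z => exp (logderiv h z)) y z) as [c [Hc ->]]; auto.
      { intros; apply has_deriv01_Diff1; auto. }
      apply Rmult_le_compat_r; [lra|].
      assert (H := HM c Hc). apply Rabs_le_between in H.
      destruct (proj1 H) as [L|L]; [left; apply exp_increasing; auto|rewrite L; lra]. }
    assert (P := exp_pos (- M)).
    apply cont01P; intros x Hx eps Heps.
    exists (exp (- M) * eps); split; [apply Rmult_lt_0_compat; auto|].
    intros y Hy Hyx.
    apply Rmult_lt_reg_l with (exp (- M)); auto.
    destruct (Hk x Hx) as [Ix Ex], (Hk y Hy) as [Iy Ey].
    eapply Rle_lt_trans; [|exact Hyx].
    destruct (Rle_dec (k x) (k y)) as [L|L].
    - specialize (HL _ _ Ix Iy L). rewrite Ex, Ey in HL.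
      rewrite (Rabs_pos_eq (k y - k x)) by lra. generalize (Rle_abs (y - x)); lra.
    - specialize (HL _ _ Iy Ix ltac:(lra)). rewrite Ex, Ey in HL.
      rewrite (Rabs_left (k y - k x)) by lra.
      generalize (Rle_abs (x - y)); rewrite Rabs_minus_sym; lra. }
  exists k; split; [|intros x Hx; split; [auto|apply Hk; auto]].
  assert (D := Hh). destruct D as [H0 [H1 _]].
  apply (Diff1_intro _ (fun y => - logderiv h (k y))).
  - generalize (Hkh 0 ltac:(unfold in01; lra)); rewrite H0; auto.
  - generalize (Hkh 1 ltac:(unfold in01; lra)); rewrite H1; auto.
  - apply (cont01_ext (fun y => 0 - logderiv h (k y))); [intros; ring|].
    apply cont01_minus; [apply cont01_const|].
    apply cont01_comp; auto using cont01_logderiv; intros; apply Hk; auto.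
  - intros y Hy. rewrite exp_Ropp.
    destruct (Hk y Hy) as [I E].
    assert (D := has_deriv01_Diff1 h (k y) Hh I).
    set (l := exp (logderiv h (k y))) in *.
    assert (Pl : 0 < l) by apply exp_pos.
    intros eps Heps.
    (* The difference quotient q of h inverts that of k, and |/q - /l| = |q - l| / (q l). *)
    set (e := Rmin (l / 2) (eps * (l * l / 2))).
    assert (Pe : 0 < e).
    { apply Rmin_glb_lt; [lra|]. apply Rmult_lt_0_compat; nra. }
    destruct (D e Pe) as [d [Pd Hd]].
    destruct (proj1 (cont01P k) Hc y Hy d Pd) as [d' [Pd' Hd']].
    exists d'; split; auto. intros z Hz n Hzy.
    destruct (Hk z Hz) as [Iz Ez].
    assert (nk : k z <> k y) by (intros C; apply n; rewrite <- Ez, <- E, C; auto).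
    specialize (Hd (k z) Iz nk (Hd' z Hz Hzy)).
    rewrite E, Ez in Hd.
    set (q := (z - y) / (k z - k y)) in *.
    assert (Hq : l / 2 < q).
    { assert (Rabs (q - l) < l / 2) by (eapply Rlt_le_trans; [exact Hd|apply Rmin_l]).
      apply Rabs_def2 in H; lra. }
    replace ((k z - k y) / (z - y)) with (/ q) by (unfold q; field; split; lra).
    replace (/ q - / l) with ((l - q) / (q * l)) by (field; lra).
    assert (Pql : l * l / 2 < q * l) by nra.
    assert (0 < q * l) by nra.
    unfold Rdiv; rewrite Rabs_mult, Rabs_inv, (Rabs_pos_eq (q * l)) by lra.
    apply Rmult_lt_reg_r with (q * l); auto.
    rewrite Rmult_assoc, Rinv_l, Rmult_1_r by lra.
    rewrite Rabs_minus_sym.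
    apply Rlt_le_trans with (eps * (l * l / 2));
      [eapply Rlt_le_trans; [exact Hd|apply Rmin_r]|].
    apply Rmult_le_compat_l; lra.
Qed.

(** Integrate exp u from 0 and divide by the total integral; the constant c comes from this
    normalization, which gives [h 1 = 1]. *)
Lemma exists_Diff1_logderiv (u : R -> R) :
  cont01 u -> exists h c, Diff1 h /\ forall x, in01 x -> logderiv h x = u x + c.
Proof.
  intros Hu.
  set (e := fun t => exp (u (clamp01 t))).
  assert (He : forall x, continuous e x).
  { intros x; unfold e. apply (continuous_comp (fun t => u (clamp01 t)) exp); auto.
    apply continuous_exp. }
  set (F := fun x => RInt e 0 x).
  assert (HF : forall x, is_derive F x (e x)).
  { intros x. apply (is_derive_RInt e F 0 x); auto.
    apply filter_forall; intros y. apply (RInt_correct e).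
    apply (ex_RInt_continuous e); auto. }
  assert (F0 : F 0 = 0) by exact (RInt_point 0 e).
  assert (F1 : 0 < F 1).
  { apply RInt_gt_0; [lra| |]; auto. intros; apply exp_pos. }
  set (c := - ln (F 1)).
  assert (D : forall x, in01 x -> has_deriv01 (fun x => F x / F 1) x (exp (u x + c))).
  { intros x Hx. apply is_derive_has_deriv01.
    replace (exp (u x + c)) with (e x / F 1).
    - apply (is_derive_ext (fun t => scal (/ F 1) (F t))).
      { intros t; unfold scal, Rdiv; simpl; unfold mult; simpl; ring. }
      replace (e x / F 1) with (scal (/ F 1) (e x))
        by (unfold scal, Rdiv; simpl; unfold mult; simpl; ring).
      apply is_derive_scal; auto.
    - unfold e, c; rewrite exp_plus, exp_Ropp, exp_ln, clamp01_id; auto. }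
  exists (fun x => F x / F 1), c; split.
  - apply (Diff1_intro _ (fun x => u x + c)); auto using cont01_plus, cont01_const.
    + rewrite F0; field; lra.
    + field; lra.
  - intros x Hx. rewrite (logderivP _ x (exp (u x + c))), ln_exp; auto.
Qed.

(** * Defects and C^1 convergence to the identity *)

Definition unif_small (c : nat -> R -> R) : Prop :=
  forall eps, 0 < eps -> exists N : nat, forall n, (N <= n)%nat ->
    forall x, in01 x -> Rabs (c n x) < eps.

(* With u = log Dh, this is log D(h g h^-1) at the point h x. *)
Definition defect (u g : R -> R) (x : R) : R := u (g x) + logderiv g x - u x.

Lemma has_deriv01_conj (h k g : R -> R) (x : R) :
  Diff1 h -> Diff1 k -> inverse01 h k -> Diff1 g -> in01 x ->
  has_deriv01 (fun y => h (g (k y))) x (exp (defect (logderiv h) g (k x))).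
Proof.
  intros Hh Hk I Hg Hx.
  replace (defect (logderiv h) g (k x))
    with (logderiv h (g (k x)) + logderiv (fun y => g (k y)) x).
  - exact (has_deriv01_Diff1_comp h _ x Hh (Diff1_comp g k Hg Hk) Hx).
  - rewrite (logderiv_comp g k), (logderiv_inverse h k) by auto. unfold defect; ring.
Qed.

Lemma exp_close_1 (eps : R) :
  0 < eps -> exists d, 0 < d /\ forall t, Rabs t < d -> Rabs (exp t - 1) < eps.
Proof.
  intros Heps.
  destruct (proj1 (filterlim_locally _ _) (continuous_exp 0) (mkposreal eps Heps)) as [d Hd].
  exists d; split; [apply cond_pos|]; intros t Ht.
  rewrite <- exp_0. apply Hd. change (Rabs (t - 0) < d). rewrite Rminus_0_r; auto.
Qed.

Lemma exp_close_1_inv (eps : R) :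
  0 < eps -> exists d, 0 < d /\ forall t, Rabs (exp t - 1) < d -> Rabs t < eps.
Proof.
  intros Heps.
  assert (P1 : 1 < exp eps) by (rewrite <- exp_0; apply exp_increasing; auto).
  assert (P2 : exp (- eps) < 1) by (rewrite <- exp_0; apply exp_increasing; lra).
  exists (Rmin (exp eps - 1) (1 - exp (- eps))); split; [apply Rmin_glb_lt; lra|].
  intros t Ht.
  assert (H1 := Rlt_le_trans _ _ _ Ht (Rmin_l _ _)).
  assert (H2 := Rlt_le_trans _ _ _ Ht (Rmin_r _ _)).
  apply Rabs_def2 in H1; apply Rabs_def2 in H2.
  apply Rabs_def1; apply exp_lt_inv; lra.
Qed.

(** Derivatives close to 1 correspond to defects close to 0, since exp is a homeomorphism onto its
    image and h maps [0,1] onto itself. Uniform closeness of values comes for free: the conjugates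
    fix 0, so by the mean value theorem the displacement at x is (l c - 1) x for some c. *)
Lemma C1_conv_id_defect (h k : nat -> R -> R) (g : R -> R) :
  (forall n, Diff1 (h n) /\ Diff1 (k n) /\ inverse01 (h n) (k n)) -> Diff1 g ->
  C1_conv_id (fun n x => h n (g (k n x))) <->
  unif_small (fun n => defect (logderiv (h n)) g).
Proof.
  intros H Hg; split; intros C eps Heps.
  - destruct (exp_close_1_inv eps Heps) as [d [Pd Hd]].
    destruct (C d Pd) as [N HN]; exists N; intros n Hn x Hx.
    destruct (H n) as [Hh [Hk I]].
    destruct (HN n Hn (h n x)) as [_ [l [Dl Hl]]]; [apply Diff1_in01; auto|].
    apply Hd.
    assert (D := has_deriv01_conj _ _ g (h n x) Hh Hk I Hg (Diff1_in01 _ _ Hh Hx)).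
    rewrite (proj1 (I x Hx)) in D.
    rewrite <- (has_deriv01_unique _ _ _ _ (Diff1_in01 _ _ Hh Hx) Dl D). exact Hl.
  - destruct (exp_close_1 eps Heps) as [d [Pd Hd]].
    destruct (C d Pd) as [N HN]; exists N; intros n Hn x Hx.
    destruct (H n) as [Hh [Hk I]].
    set (l := fun y => exp (defect (logderiv (h n)) g (k n y))).
    assert (D : forall y, in01 y -> has_deriv01 (fun y => h n (g (k n y))) y (l y))
      by (intros; apply has_deriv01_conj; auto).
    assert (L : forall y, in01 y -> Rabs (l y - 1) < eps).
    { intros y Hy; apply Hd, HN; auto. apply Diff1_in01; auto. }
    split; [|exists (l x); auto].
    destruct (mean_value01 _ l 0 x D) as [c [Hc E]]; try (unfold in01 in *; lra).
    destruct Hh as [h0 _], Hg as [g0 _], Hk as [k0 _].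
    rewrite k0, g0, h0 in E.
    replace (h n (g (k n x)) - x) with ((l c - 1) * x) by lra.
    rewrite Rabs_mult, (Rabs_pos_eq x) by apply Hx.
    generalize (L c Hc) (Rabs_pos (l c - 1)); unfold in01 in Hx; nra.
Qed.

(** The defect is a cocycle: at x, that of g after h is the defect of g at [h x] plus the defect of
    h at x, and that of the inverse k of g is minus the defect of g at [k x]. Smallness thus passes
    from the generators to every word. *)
Lemma unif_small_gen_group (u : nat -> R -> R) (f : R -> R) (G : (R -> R) -> Prop) :
  (forall g, G g -> Diff1 g) -> Diff1 f ->
  (forall g, G g -> unif_small (fun n => defect (u n) g)) ->
  unif_small (fun n => defect (u n) f) ->
  forall g, gen_group f G g -> Diff1 g /\ unif_small (fun n => defect (u n) g).
Proof.
  intros HG Hf SG Sf g Hg.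
  induction Hg as [| |g Gg|g h _ [Dg Sg] _ [Dh Sh]|g k _ [Dg Sg] Dk I]; auto.
  - split; [apply Diff1_id|]. intros eps Heps; exists 0%nat; intros n _ x Hx.
    unfold defect; rewrite logderiv_id by auto.
    replace (_ - _) with 0 by ring; rewrite Rabs_R0; auto.
  - split; [apply Diff1_comp; auto|]. intros eps Heps.
    destruct (Sg (eps / 2)) as [N1 H1]; [lra|].
    destruct (Sh (eps / 2)) as [N2 H2]; [lra|].
    exists (max N1 N2); intros n Hn x Hx.
    replace (defect (u n) (fun y => g (h y)) x)
      with (defect (u n) g (h x) + defect (u n) h x)
      by (unfold defect; rewrite (logderiv_comp g h) by auto; ring).
    specialize (H1 n ltac:(lia) (h x) (Diff1_in01 h x Dh Hx)).
    specialize (H2 n ltac:(lia) x Hx).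
    eapply Rle_lt_trans; [apply Rabs_triang|]; lra.
  - split; [auto|]. intros eps Heps.
    destruct (Sg eps Heps) as [N H]; exists N; intros n Hn x Hx.
    replace (defect (u n) k x) with (- defect (u n) g (k x)).
    + rewrite Rabs_Ropp. apply H; auto. apply Diff1_in01; auto.
    + unfold defect; rewrite (logderiv_inverse g k) by auto.
      rewrite (proj2 (I x Hx)); ring.
Qed.

(** * Birkhoff sums and an almost coboundary for log Df *)

Fixpoint birkhoff (T phi : R -> R) (n : nat) (x : R) : R :=
  match n with O => 0 | S m => phi x + birkhoff T phi m (T x) end.

(* Starting from the Birkhoff sum of length 1, not 0, makes [cesaro_wandering] exact. *)
Fixpoint cesaro (T phi : R -> R) (n : nat) (x : R) : R :=
  match n with O => 0 | S m => cesaro T phi m x + birkhoff T phi (S m) x end.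

(** With S_m the Birkhoff sum of length m, S_(m+1)(x) = phi(x) + S_m(T x), so the difference
    telescopes. After division by n, the mean solves the cohomological equation for -phi up to S_n(T
    x) / n. *)
Lemma cesaro_shift (T phi : R -> R) (n : nat) (x : R) :
  cesaro T phi n (T x) - cesaro T phi n x = birkhoff T phi n (T x) - INR n * phi x.
Proof.
  induction n as [|n IH]; [simpl; ring|].
  rewrite S_INR. cbn [cesaro].
  replace (birkhoff T phi (S n) x) with (phi x + birkhoff T phi n (T x)) by reflexivity.
  lra.
Qed.

Lemma cont01_birkhoff (T phi : R -> R) (n : nat) :
  Diff1 T -> cont01 phi -> cont01 (birkhoff T phi n).
Proof.
  intros HT Hphi. induction n as [|n IH]; simpl; [apply cont01_const|].
  apply cont01_plus; auto. apply cont01_comp; auto using cont01_Diff1, Diff1_in01.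
Qed.

Lemma cont01_cesaro (T phi : R -> R) (n : nat) :
  Diff1 T -> cont01 phi -> cont01 (cesaro T phi n).
Proof.
  intros HT Hphi. induction n as [|n IH]; cbn [cesaro]; [apply cont01_const|].
  apply cont01_plus; auto using cont01_birkhoff.
Qed.

(* The total displacement along a monotone orbit is at most 1. *)
Lemma birkhoff_displacement (f phi : R -> R) (e C : R) :
  Diff1 f -> 0 <= C ->
  (forall x, in01 x -> Rabs (phi x) <= e + C * Rabs (f x - x)) ->
  forall n x, in01 x -> Rabs (birkhoff f phi n x) <= INR n * e + C.
Proof.
  intros Hf HC H.
  (* The factor [1 - x] is the room left for an increasing orbit; a step uses up [f x - x] of it.
     For decreasing orbits the room is x. *)
  assert (U : forall n x, in01 x -> x <= f x ->
    Rabs (birkhoff f phi n x) <= INR n * e + C * (1 - x)).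
  { induction n as [|n IH]; intros x Hx Hfx.
    - simpl; rewrite Rabs_R0. unfold in01 in Hx; nra.
    - rewrite S_INR; cbn [birkhoff].
      assert (I := Diff1_in01 f x Hf Hx).
      specialize (IH (f x) I (Diff1_incr_le f _ _ Hf Hx I Hfx)).
      specialize (H x Hx). rewrite (Rabs_pos_eq (f x - x)) in H by lra.
      eapply Rle_trans; [apply Rabs_triang|]; nra. }
  assert (L : forall n x, in01 x -> f x <= x ->
    Rabs (birkhoff f phi n x) <= INR n * e + C * x).
  { induction n as [|n IH]; intros x Hx Hfx.
    - simpl; rewrite Rabs_R0. unfold in01 in Hx; nra.
    - rewrite S_INR; cbn [birkhoff].
      assert (I := Diff1_in01 f x Hf Hx).
      specialize (IH (f x) I (Diff1_incr_le f _ _ Hf I Hx Hfx)).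
      specialize (H x Hx). rewrite (Rabs_left1 (f x - x)) in H by lra.
      eapply Rle_trans; [apply Rabs_triang|]; nra. }
  intros n x Hx. destruct (Rle_dec x (f x)) as [c|c].
  - specialize (U n x Hx c). unfold in01 in Hx; nra.
  - specialize (L n x Hx ltac:(lra)). unfold in01 in Hx; nra.
Qed.

(** By compactness: log Df vanishes at the fixed points, so the displacement is bounded below where
    |log Df| >= e, and there a large multiple of it dominates the bounded function log Df. *)
Lemma logderiv_le_displacement (f : R -> R) (e : R) :
  Diff1 f -> no_hyperbolic_fixed_points f -> 0 < e ->
  exists C, 0 < C /\ forall x, in01 x -> Rabs (logderiv f x) <= e + C * Rabs (f x - x).
Proof.
  intros Hf Hn He.
  destruct (cont01_bounded _ (cont01_logderiv f Hf)) as [M [PM HM]].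
  (* The added term is 2 max(0, e - |log Df|). It is positive at fixed points and zero where |log
     Df| >= e, so a minimum over all of [0,1] replaces one over that subset. *)
  destruct (cont01_min (fun x => Rabs (f x - x) +
      (Rabs (e - Rabs (logderiv f x)) + (e - Rabs (logderiv f x)))))
    as [m [Hm Hmin]].
  { apply cont01_plus.
    - apply (cont01_post Rabs); [|intros; apply continuous_Rabs].
      apply cont01_minus; [apply cont01_Diff1|apply (cont01_Diff1 _ Diff1_id)]; auto.
    - assert (Ce : cont01 (fun x => e - Rabs (logderiv f x))).
      { apply cont01_minus; [apply cont01_const|].
        apply (cont01_post Rabs); [apply cont01_logderiv; auto|].
        intros; apply continuous_Rabs. }
      apply cont01_plus; auto. apply (cont01_post Rabs); auto.
      intros; apply continuous_Rabs. }
  set (mu := Rabs (f m - m) +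
    (Rabs (e - Rabs (logderiv f m)) + (e - Rabs (logderiv f m)))) in *.
  assert (Pmu : 0 < mu).
  { unfold mu. generalize (Rabs_pos (f m - m)) (Rle_abs (- (e - Rabs (logderiv f m)))); intros P Q.
    rewrite Rabs_Ropp in Q.
    destruct (Req_dec (f m) m) as [E|E].
    - assert (X := Hn m Hm E _ (has_deriv01_Diff1 f m Hf Hm)).
      assert (Z : logderiv f m = 0) by (apply exp_inv; rewrite X, exp_0; auto).
      rewrite Z, Rabs_R0, Rminus_0_r, (Rabs_pos_eq e); lra.
    - assert (0 < Rabs (f m - m)) by (apply Rabs_pos_lt; lra). lra. }
  exists (M / mu); split; [apply Rdiv_lt_0_compat; auto|].
  intros x Hx. specialize (Hmin x Hx). specialize (HM x Hx).
  assert (P := Rabs_pos (f x - x)).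
  assert (0 < M / mu) by (apply Rdiv_lt_0_compat; auto).
  destruct (Rle_dec (Rabs (logderiv f x)) e) as [c|c]; [nra|].
  rewrite (Rabs_left (e - _)) in Hmin by lra.
  assert (M / mu * mu = M) by (field; lra). nra.
Qed.

Lemma exists_almost_coboundary (f : R -> R) :
  Diff1 f -> no_hyperbolic_fixed_points f ->
  exists w : nat -> R -> R, (forall n, cont01 (w n)) /\
    unif_small (fun n => defect (w n) f).
Proof.
  intros Hf Hn.
  exists (fun n x => / INR n * cesaro f (logderiv f) n x); split.
  { intros n; apply cont01_mult; auto using cont01_const, cont01_cesaro, cont01_logderiv. }
  intros eps Heps.
  destruct (logderiv_le_displacement f (eps / 2) Hf Hn) as [C [PC HC]]; [lra|].
  (* The defect is at most eps / 2 + C / n, which is less than eps once n > 2 C / eps. Starting at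
     [S N] keeps n positive, so that [/ INR n] is a true inverse. *)
  destruct (INR_unbounded (2 * C / eps)) as [N HN].
  exists (S N); intros n Hle x Hx.
  assert (Hn2 : 2 * C / eps < INR n).
  { eapply Rlt_le_trans; [exact HN|apply le_INR; lia]. }
  assert (Pn : 0 < INR n) by (apply lt_0_INR; lia).
  replace (defect _ f x) with (/ INR n * birkhoff f (logderiv f) n (f x)).
  - rewrite Rabs_mult, Rabs_pos_eq by (left; apply Rinv_0_lt_compat; auto).
    assert (B := birkhoff_displacement f _ (eps / 2) C Hf ltac:(lra) HC n (f x)
      (Diff1_in01 f x Hf Hx)).
    apply Rmult_lt_reg_l with (INR n); auto.
    rewrite <- Rmult_assoc, Rinv_r, Rmult_1_l by lra.
    assert (2 * C < INR n * eps).
    { apply Rmult_lt_reg_r with (/ eps); [apply Rinv_0_lt_compat; auto|].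
      replace (INR n * eps * / eps) with (INR n) by (field; lra). exact Hn2. }
    lra.
  - assert (E := cesaro_shift f (logderiv f) n x).
    unfold defect.
    replace (birkhoff f (logderiv f) n (f x)) with
      (cesaro f (logderiv f) n (f x) - cesaro f (logderiv f) n x + INR n * logderiv f x)
      by lra.
    field; lra.
Qed.

(** * Wandering bumps and almost invariant extensions *)

Lemma birkhoff_trapped (T phi : R -> R) (Z : R -> Prop) :
  (forall x, Z x -> Z (T x)) -> (forall x, Z x -> phi x = 0) ->
  forall n x, Z x -> birkhoff T phi n x = 0.
Proof.
  intros HT Hphi n; induction n as [|n IH]; intros x Hx; simpl; auto.
  rewrite Hphi, IH by auto; ring.
Qed.

Section WanderingBump.

(** U carries phi, and Z traps the orbits that leave U in a region where phi vanishes. So every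
    forward orbit in [0,1] meets the set where phi is nonzero at most once. *)
Variables (T phi : R -> R) (U Z : R -> Prop) (M : R).
Hypothesis T01 : forall x, in01 x -> in01 (T x).
Hypothesis TU : forall x, U x -> Z (T x).
Hypothesis TZ : forall x, Z x -> Z (T x).
Hypothesis phiZ : forall x, Z x -> phi x = 0.
Hypothesis phiU : forall x, in01 x -> phi x <> 0 -> U x.
Hypothesis phiM : forall x, in01 x -> Rabs (phi x) <= M.

Lemma birkhoff_wandering (n : nat) (x : R) : U x -> birkhoff T phi (S n) x = phi x.
Proof.
  intros Hx; simpl. rewrite (birkhoff_trapped T phi Z) by auto. ring.
Qed.

Lemma cesaro_wandering (n : nat) (x : R) : U x -> cesaro T phi n x = INR n * phi x.
Proof.
  intros Hx; induction n as [|n IH]; [simpl; ring|].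
  rewrite S_INR; cbn [cesaro]. rewrite IH, birkhoff_wandering by auto. ring.
Qed.

(** At most one term of the sum is nonzero, whence a bound independent of n. *)
Lemma birkhoff_wandering_bound (n : nat) (x : R) :
  in01 x -> Rabs (birkhoff T phi n x) <= M.
Proof.
  assert (PM : 0 <= M).
  { apply Rle_trans with (Rabs (phi 0)); [apply Rabs_pos|apply phiM; unfold in01; lra]. }
  revert x; induction n as [|n IH]; intros x Hx; [simpl; rewrite Rabs_R0; auto|].
  destruct (Req_dec (phi x) 0) as [E|E].
  - cbn [birkhoff]; rewrite E, Rplus_0_l; auto.
  - rewrite birkhoff_wandering; auto.
Qed.

End WanderingBump.

Lemma exists_bump (a' a b b' : R) (s : R -> R) :
  a' < a -> b < b' -> cont01 s ->
  exists s0, cont01 s0 /\ (forall x, a <= x <= b -> s0 x = s x) /\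
    forall x, s0 x <> 0 -> a' < x < b'.
Proof.
  intros Ha Hb Hs.
  set (p := clamp01).
  assert (Cp : forall t, continuous p t).
  { intros t; apply filterlim_locally; intros e; exists e; intros y Hy.
    eapply Rle_lt_trans; [apply (clamp01_lipschitz y t)|exact Hy]. }
  assert (Ca : forall c d x, continuous (fun x => p ((x - c) / d)) x).
  { intros c d x. apply (continuous_comp (fun x => (x - c) / d) p); auto.
    apply (continuous_mult (fun x => x - c) (fun _ => / d)); [|apply continuous_const].
    apply (continuous_minus (fun x => x) (fun _ => c));
      [apply continuous_id|apply continuous_const]. }
  assert (P1 : forall t, 1 <= t -> p t = 1).
  { intros t Ht; unfold p, clamp01; rewrite Rmin_left, Rmax_right; lra. }
  assert (P0 : forall t, t <= 0 -> p t = 0).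
  { intros t Ht; unfold p, clamp01; rewrite Rmin_right, Rmax_left; lra. }
  (* One clamped affine ramp rises from 0 at a' to 1 at a, the other falls from 1 at b to 0 at
     b'. *)
  exists (fun x => s x * (p ((x - a') / (a - a')) * p ((x - b') / (b - b')))).
  split; [|split].
  - apply cont01_mult; auto.
    apply cont01_mult; apply cont01_of_continuous; intros; apply Ca.
  - intros x Hx. rewrite !P1, !Rmult_1_r; auto.
    + replace ((x - b') / (b - b')) with (1 + (b - x) / (b' - b)) by (field; lra).
      assert (0 <= (b - x) / (b' - b)); [|lra].
      apply Rmult_le_pos; [lra|left; apply Rinv_0_lt_compat; lra].
    + replace ((x - a') / (a - a')) with (1 + (x - a) / (a - a')) by (field; lra).
      assert (0 <= (x - a) / (a - a')); [|lra].
      apply Rmult_le_pos; [lra|left; apply Rinv_0_lt_compat; lra].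
  - intros x Hx. split; apply Rnot_le_lt; intros L; apply Hx.
    + rewrite (P0 ((x - a') / (a - a'))); [ring|].
      replace ((x - a') / (a - a')) with (- ((a' - x) / (a - a'))) by (field; lra).
      assert (0 <= (a' - x) / (a - a')); [|lra].
      apply Rmult_le_pos; [lra|left; apply Rinv_0_lt_compat; lra].
    + rewrite (P0 ((x - b') / (b - b'))); [ring|].
      replace ((x - b') / (b - b')) with (- ((x - b') / (b' - b))) by (field; lra).
      assert (0 <= (x - b') / (b' - b)); [|lra].
      apply Rmult_le_pos; [lra|left; apply Rinv_0_lt_compat; lra].
Qed.

(** The case where f moves the segment to its right, so that forward orbits of the bump escape
    upwards and backward orbits downwards. *)
Lemma almost_invariant_extension_right (f k : R -> R) (a b : R) (s : R -> R) (eps : R) :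
  0 < a -> a < b -> b < 1 -> Diff1 f -> Diff1 k -> inverse01 f k -> b < f a ->
  cont01 s -> 0 < eps ->
  exists S, cont01 S /\ (forall x, a <= x <= b -> S x = s x) /\
    forall x, in01 x -> Rabs (S (f x) - S x) < eps.
Proof.
  intros Ha Hab Hb Hf Hk I Hfa Hs Heps.
  assert (Ifa : in01 (f a)) by (apply Diff1_in01; auto; unfold in01; lra).
  (* Since [f a' = b'], the interval from a' to b' is a fundamental domain of f, and it contains
     [a, b] in its interior. A bump supported in it is wandering for f and for k. *)
  set (b' := (b + f a) / 2). set (a' := k b').
  assert (Ib' : in01 b') by (unfold b', in01 in *; lra).
  assert (Ia' : in01 a') by (apply Diff1_in01; auto).
  assert (E : f a' = b') by (apply I; auto).
  assert (La' : a' < a).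
  { apply (Diff1_lt_inv f); auto; [unfold in01; lra|]. rewrite E; unfold b'; lra. }
  assert (Lab : a' < b') by (unfold b'; lra).
  destruct (exists_bump a' a b b' s La' ltac:(unfold b'; lra) Hs) as [s0 [C0 [E0 Z0]]].
  destruct (cont01_bounded s0 C0) as [M [PM HM]].
  set (U := fun x => in01 x /\ a' < x < b').
  (* The inequality between x and its next iterate is preserved by monotonicity and makes the
     trapping sets invariant. *)
  set (Zf := fun x => in01 x /\ b' <= x <= f x).
  set (Zk := fun x => in01 x /\ k x <= x <= a').
  assert (U0 : forall x, in01 x -> s0 x <> 0 -> U x) by (intros; split; auto).
  assert (fU : forall x, U x -> Zf (f x)).
  { intros x [Hx Lx]. assert (Ix := Diff1_in01 f x Hf Hx).
    assert (b' <= f x) by (rewrite <- E; apply Diff1_incr_le; auto; lra).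
    repeat split; try apply Ix; auto. apply Diff1_incr_le; auto; lra. }
  assert (fZ : forall x, Zf x -> Zf (f x)).
  { intros x [Hx Lx]. assert (Ix := Diff1_in01 f x Hf Hx).
    repeat split; try apply Ix; [lra|]. apply Diff1_incr_le; auto; lra. }
  assert (kU : forall x, U x -> Zk (k x)).
  { intros x [Hx Lx]. assert (Ix := Diff1_in01 k x Hk Hx).
    assert (k x <= a') by (apply Diff1_incr_le; auto; lra).
    repeat split; try apply Ix; auto. apply Diff1_incr_le; auto; lra. }
  assert (kZ : forall x, Zk x -> Zk (k x)).
  { intros x [Hx Lx]. assert (Ix := Diff1_in01 k x Hk Hx).
    repeat split; try apply Ix; [|lra]. apply Diff1_incr_le; auto; lra. }
  assert (Zf0 : forall x, Zf x -> s0 x = 0).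
  { intros x [Hx Lx]. destruct (Req_dec (s0 x) 0) as [|n]; auto.
    generalize (Z0 x n); lra. }
  assert (Zk0 : forall x, Zk x -> s0 x = 0).
  { intros x [Hx Lx]. destruct (Req_dec (s0 x) 0) as [|n]; auto.
    generalize (Z0 x n); lra. }
  destruct (INR_unbounded (2 * M / eps)) as [n Hn].
  assert (Pn : 0 < INR n).
  { apply Rlt_trans with (2 * M / eps); auto. apply Rdiv_lt_0_compat; lra. }
  (* Each mean weights s0 at the j-th iterate by 1 - j/n. Both count j = 0, so s0 is subtracted
     once; this also cancels the terms s0(x) and s0(f x) in the difference under f, leaving two
     Birkhoff sums, each bounded by M, over n. *)
  exists (fun x => / INR n * (cesaro f s0 n x + cesaro k s0 n x) - s0 x).
  split; [|split].
  - apply cont01_minus; auto. apply cont01_mult; [apply cont01_const|].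
    apply cont01_plus; apply cont01_cesaro; auto.
  - intros x Hx. assert (Ux : U x) by (unfold U, in01, b' in *; lra).
    rewrite (cesaro_wandering f s0 U Zf), (cesaro_wandering k s0 U Zk) by auto.
    rewrite E0 by auto. field; lra.
  - intros x Hx. assert (Ix := Diff1_in01 f x Hf Hx).
    assert (Ef := cesaro_shift f s0 n x).
    assert (Ek := cesaro_shift k s0 n (f x)).
    rewrite (proj1 (I x Hx)) in Ek.
    assert (Bf : Rabs (birkhoff f s0 n (f x)) <= M).
    { apply (birkhoff_wandering_bound f s0 U Zf); auto; intros; apply Diff1_in01; auto. }
    assert (Bk : Rabs (birkhoff k s0 n x) <= M).
    { apply (birkhoff_wandering_bound k s0 U Zk); auto; intros; apply Diff1_in01; auto. }
    match goal with |- Rabs ?t < _ =>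
      replace t with (/ INR n * (birkhoff f s0 n (f x) - birkhoff k s0 n x)) end.
    + rewrite Rabs_mult, Rabs_pos_eq by (left; apply Rinv_0_lt_compat; auto).
      apply Rmult_lt_reg_l with (INR n); auto.
      rewrite <- Rmult_assoc, Rinv_r, Rmult_1_l by lra.
      apply Rle_lt_trans with (2 * M).
      * apply Rabs_le_between in Bf. apply Rabs_le_between in Bk. apply Rabs_le_between; lra.
      * apply Rmult_lt_reg_r with (/ eps); [apply Rinv_0_lt_compat; auto|].
        replace (INR n * eps * / eps) with (INR n) by (field; lra). exact Hn.
    + replace (birkhoff f s0 n (f x)) with
        (cesaro f s0 n (f x) - cesaro f s0 n x + INR n * s0 x) by lra.
      replace (birkhoff k s0 n x) with
        (cesaro k s0 n x - cesaro k s0 n (f x) + INR n * s0 (f x)) by lra.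
      field; lra.
Qed.

(** Being disjoint from the segment, its image lies wholly on one side. If it lies to the left, the
    inverse k moves the segment to the right, and almost invariance under k at [f x] is almost
    invariance under f at x. *)
Lemma almost_invariant_extension (f : R -> R) (a b : R) (s : R -> R) (eps : R) :
  0 < a -> a < b -> b < 1 -> Diff1 f ->
  (forall x, a <= x <= b -> ~ (a <= f x <= b)) -> cont01 s -> 0 < eps ->
  exists S, cont01 S /\ (forall x, a <= x <= b -> S x = s x) /\
    forall x, in01 x -> Rabs (S (f x) - S x) < eps.
Proof.
  intros Ha Hab Hb Hf Hd Hs Heps.
  assert (Ia : in01 a) by (unfold in01; lra).
  assert (Ib : in01 b) by (unfold in01; lra).
  destruct (Diff1_inverse f Hf) as [k [Hk I]].
  destruct (Rlt_dec b (f a)) as [c|c].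
  - apply (almost_invariant_extension_right f k); auto.
  - assert (Hfa : f a < a) by (generalize (Hd a ltac:(lra)); lra).
    assert (Ika := Diff1_in01 k a Hk Ia).
    (* From f a < a = f (k a) follows a < k a; if also k a <= b, then [k a] would be a point of the
       segment sent to a. *)
    assert (Lb : b < k a).
    { apply Rnot_le_lt; intros L. apply (Hd (k a)).
      - split; auto. left; apply (Diff1_lt_inv f); auto.
        rewrite (proj2 (I a Ia)); auto.
      - rewrite (proj2 (I a Ia)); lra. }
    destruct (almost_invariant_extension_right k f a b s eps) as [S [CS [ES HS]]];
      auto using inverse01_sym.
    exists S; split; [auto|split; auto]. intros x Hx.
    specialize (HS (f x) (Diff1_in01 f x Hf Hx)).
    rewrite (proj1 (I x Hx)), Rabs_minus_sym in HS; auto.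
Qed.

(** * Diffeomorphisms supported in the segment *)

(** If [g x] were outside the segment it would be fixed by g, so x and [g x] would be distinct
    points with the same image, against injectivity. *)
Lemma supported_in_stable (a b : R) (g : R -> R) (x : R) :
  0 < a -> b < 1 -> Diff1 g -> supported_in a b g -> a <= x <= b -> a <= g x <= b.
Proof.
  intros Ha Hb Hg Hs Hx.
  assert (Ix : in01 x) by (unfold in01; lra).
  assert (Igx := Diff1_in01 g x Hg Ix).
  split; apply Rnot_lt_le; intros L.
  - assert (E := Hs (g x) Igx (or_introl L)).
    generalize (Diff1_incr g _ _ Hg Igx Ix ltac:(lra)); lra.
  - assert (E := Hs (g x) Igx (or_intror L)).
    generalize (Diff1_incr g _ _ Hg Ix Igx ltac:(lra)); lra.
Qed.

Lemma logderiv_outside_support (a b : R) (g : R -> R) (x : R) :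
  supported_in a b g -> in01 x -> x < a \/ b < x -> logderiv g x = 0.
Proof.
  intros Hs Hx Hab. rewrite (logderivP g x 1), ln_1; auto.
  assert (P : exists d, 0 < d /\ forall y, Rabs (y - x) < d -> y < a \/ b < y).
  { destruct Hab as [L|L]; [exists (a - x)|exists (x - b)]; (split; [lra|]);
      intros y Hy; apply Rabs_def2 in Hy; [left|right]; lra. }
  destruct P as [d [Pd Hd]]. intros eps Heps; exists d; split; auto.
  intros y Hy n Hyx. rewrite (Hs y Hy (Hd y Hyx)), (Hs x Hx Hab).
  replace ((y - x) / (y - x) - 1) with 0 by (field; lra). rewrite Rabs_R0; auto.
Qed.

(** Outside the segment g is locally the identity and its defect is 0 whatever u is; inside, both x
    and [g x] lie where u and v agree. *)
Lemma defect_congr (a b : R) (u v g : R -> R) (x : R) :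
  0 < a -> b < 1 -> Diff1 g -> supported_in a b g ->
  (forall y, a <= y <= b -> u y = v y) -> in01 x ->
  Rabs (defect u g x) <= Rabs (defect v g x).
Proof.
  intros Ha Hb Hg Hs E Hx. unfold defect.
  destruct (Rlt_dec x a) as [L|L]; [|destruct (Rlt_dec b x) as [L'|L']].
  - rewrite (logderiv_outside_support a b g x Hs), (Hs x) by auto.
    right; f_equal; ring.
  - rewrite (logderiv_outside_support a b g x Hs), (Hs x) by auto.
    right; f_equal; ring.
  - assert (a <= x <= b) by lra.
    rewrite !E by (auto; apply supported_in_stable; auto). lra.
Qed.

(** * Conjugating diffeomorphisms for the generated group *)

Theorem theoremt (a b : R) (G : (R -> R) -> Prop) (f : R -> R) :
  0 < a -> a < b -> b < 1 ->
  IsGroup G ->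
  (forall g, G g -> supported_in a b g) ->
  C1_close_to_id G ->
  Diff1 f ->
  no_hyperbolic_fixed_points f ->
  (forall x, a <= x <= b -> ~ (a <= f x <= b)) ->
  C1_close_to_id (gen_group f G).
Proof.
  intros Ha Hab Hb [DG _] SG [h [hinv [Hh HG]]] Hf Hn Hd.
  destruct (exists_almost_coboundary f Hf Hn) as [w [Cw Sw]].
  assert (HS : forall n, exists S, cont01 S /\
    (forall x, a <= x <= b -> S x = logderiv (h n) x - w n x) /\
    forall x, in01 x -> Rabs (S (f x) - S x) < / INR (n + 1)).
  { intros n.
    apply (almost_invariant_extension f a b (fun x => logderiv (h n) x - w n x)); auto.
    - apply cont01_minus; auto. apply cont01_logderiv, Hh.
    - apply Rinv_0_lt_compat, lt_0_INR; lia. }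
  assert (HH : forall n, exists p : (R -> R) * (R -> R),
    (Diff1 (fst p) /\ Diff1 (snd p) /\ inverse01 (fst p) (snd p)) /\
    (forall g x, Diff1 g -> supported_in a b g -> in01 x ->
      Rabs (defect (logderiv (fst p)) g x) <= Rabs (defect (logderiv (h n)) g x)) /\
    (forall x, in01 x ->
      Rabs (defect (logderiv (fst p)) f x) <= Rabs (defect (w n) f x) + / INR (n + 1))).
  { intros n. destruct (HS n) as [S [CS [ES BS]]].
    destruct (exists_Diff1_logderiv (fun x => w n x + S x)) as [H [c [DH EH]]];
      [apply cont01_plus; auto|].
    destruct (Diff1_inverse H DH) as [K [DK I]].
    (* The additive constant c cancels in the defect. *)
    assert (EQ : forall g x, Diff1 g -> in01 x ->
      defect (logderiv H) g x = defect (fun x => w n x + S x) g x).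
    { intros g x Dg Hx; unfold defect.
      rewrite !EH by auto using Diff1_in01; ring. }
    exists (H, K); simpl; split; [auto|split].
    (* On the segment w_n + S equals log Dh_n, so elements supported there keep the defect that h_n
       gives them. *)
    - intros g x Dg Sg Hx. rewrite EQ by auto.
      apply (defect_congr a b); auto. intros y Hy; rewrite ES by auto; ring.
    - intros x Hx. rewrite EQ by auto.
      replace (defect (fun x => w n x + S x) f x)
        with (defect (w n) f x + (S (f x) - S x)) by (unfold defect; ring).
      eapply Rle_trans; [apply Rabs_triang|]. specialize (BS x Hx); lra. }
  (* Choice turns the existence for each n into sequences of conjugators and their inverses. *)
  set (p := fun n => proj1_sig (constructive_indefinite_description _ (HH n))).
  assert (Hp := fun n => proj2_sig (constructive_indefinite_description _ (HH n))).
  fold p in Hp.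
  exists (fun n => fst (p n)), (fun n => snd (p n)).
  split; [intros n; apply Hp|]. intros g Hg.
  destruct (unif_small_gen_group (fun n => logderiv (fst (p n))) f G) with (g := g)
    as [Dg Sg]; auto.
  - intros g' Gg' eps Heps.
    destruct (proj1 (C1_conv_id_defect h hinv g' Hh (DG g' Gg')) (HG g' Gg') eps Heps)
      as [N HN].
    exists N; intros n Hle x Hx.
    destruct (Hp n) as [_ [Q _]].
    eapply Rle_lt_trans; [apply Q|apply HN]; auto.
  - intros eps Heps.
    (* Half of eps goes to the defect of w_n, the other half to the error 1/(n+1) of the almost
       invariant extension. *)
    destruct (Sw (eps / 2)) as [N HN]; [lra|].
    destruct (INR_unbounded (2 / eps)) as [N' HN'].
    exists (max N N'); intros n Hle x Hx.
    destruct (Hp n) as [_ [_ Q]].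
    eapply Rle_lt_trans; [apply Q; auto|].
    specialize (HN n ltac:(lia) x Hx).
    assert (/ INR (n + 1) < eps / 2); [|lra].
    replace (eps / 2) with (/ (2 / eps)) by (field; lra).
    apply Rinv_lt_contravar.
    + apply Rmult_lt_0_compat; [apply Rdiv_lt_0_compat; lra|apply lt_0_INR; lia].
    + eapply Rlt_le_trans; [exact HN'|apply le_INR; lia].
  - apply (C1_conv_id_defect (fun n => fst (p n)) (fun n => snd (p n)) g); auto.
    intros n; apply Hp.
Qed.
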